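(* For every $n\ge 8$, the symmetric group $G^+=S_n$ admits a subgroup $G$ which contains conjugacy classes $C_1,C_2$ (of $G$) satisfying $C_1^+=C_2^+$, but $r_G(g_{C_1})<r_G(g_{C_2})$, where $g_{C_i}\in C_i$ ($i=1,2$).
   Context: For a finite group $G$ and $g\in G$, $r_G(g):=\#\{h\in G: h^2=g\}$ (this depends only on the conjugacy class of $g$ in $G$). For a subgroup $G$ of a group $G^+$ and a conjugacy class $C$ of $G$, $C^+$ denotes the unique conjugacy class of $G^+$ containing $C$, i.e. $C^+=\bigcup_{a\in G^+}aCa^{-1}$. *)

(* Defs.v *)
From mathcomp Require Import all_boot all_fingroup.

Set Implicit Arguments.
Unset Strict Implicit.
Unset Printing Implicit Defensive.

Local Open Scope group_scope.

Definition nsqrt (gT : finGroupType) (G : {group gT}) (g : gT) : nat :=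
  #|[set h in G | h ^+ 2 == g]|.

Lemma nsqrtJ (gT : finGroupType) (G : {group gT}) (g a : gT) :
  a \in G -> nsqrt G (g ^ a) = nsqrt G g.
Proof.
move=> aG; rewrite /nsqrt -[RHS](card_imset _ (conjg_inj a)); apply: eq_card => x.
rewrite inE; apply/andP/imsetP=> [[xG /eqP xx] | [h]].
  exists (x ^ a^-1); last by rewrite conjgKV.
  by rewrite inE groupJ ?groupV // -conjXg xx conjgK eqxx.
by rewrite inE => /andP[hG /eqP hh] ->; rewrite groupJ // -conjXg hh eqxx.
Qed.

(* C^+ is [class_support C Gp], the union of the conjugates of C under Gp. *)
Lemma class_support_classes (gT : finGroupType) (G Gp : {group gT})
    (C D : {set gT}) :
  G \subset Gp -> C \in classes G ->
  (D \in classes Gp) && (C \subset D) = (D == class_support C Gp).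
Proof.
move=> sGGp /imsetP[x xG ->].
have xGp := subsetP sGGp x xG.
have -> : class_support (x ^: G) Gp = x ^: Gp.
  apply/setP=> y; apply/imset2P/imsetP=> [[_ b /imsetP[a aG ->] bGp ->]|[b bGp ->]].
    by exists (a * b); rewrite ?conjgM // groupM // (subsetP sGGp).
  by exists x b; rewrite ?class_refl.
apply/andP/eqP=> [[/imsetP[y yGp ->] /subsetP sub] | ->].
  by apply: class_eqP; rewrite class_sym sub ?class_refl.
by rewrite mem_classes // imsetS.
Qed.

(* Main.v *)
Require Import Defs.
From mathcomp Require Import all_boot all_fingroup.

Local Open Scope group_scope.

(** The number of square roots of an element of [G] is not determined by its
    class in a larger group [G^+]: in [G = C_4 x C_2 = <[a]> x <[b]>] every square
    is a power of [a], so [b] has no square root, while [a ^+ 2] has one.  It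
    remains to embed [G] into [S_n] so that the involutions [a ^+ 2] and [b] have
    the same cycle type.  Eight points suffice: let [a] be a 4-cycle on
    {0, 1, 2, 3} and [b] a product of two disjoint transpositions of
    {4, 5, 6, 7}; then [a ^+ 2] is a product of two disjoint transpositions as
    well.

    [nsqrt_lt_of_conj_sqr] is the abstract argument in any finite group, and
    [exists_conj_sqr] provides [a] and [b]. *)

Section ConjugateSquare.

Variable gT : finGroupType.
Implicit Types (a b c x u : gT) (G H : {group gT}).

(** [b] has no square root because squaring [a ^+ i * b ^+ j] kills the
    [b]-component. *)
Lemma nsqrt_join_cycle_eq0 a b :
  commute a b -> b ^+ 2 = 1 -> b \notin <[a]> ->
  nsqrt (<[a]> <*> <[b]>)%G b = 0.
Proof.
move=> cab b2 bNa; apply: eq_card0 => h; rewrite inE; apply/negP=> /andP[].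
have sba : <[b]> \subset 'C(<[a]>).
  by rewrite cent_cycle cycle_subG; apply/cent1P.
rewrite /= cent_joinEr // => /mulsgP[_ _ /cycleP[i ->] /cycleP[j ->] ->].
rewrite expgMn; last by apply: commuteX2.
rewrite -(expgM b) mulnC (expgM b) b2 expg1n mulg1 => /eqP ab.
by case/negP: bNa; rewrite -ab -expgM mem_cycle.
Qed.

Lemma class_support_classJ G x c :
  class_support ((x ^ c) ^: G) [set: gT] = class_support (x ^: G) [set: gT].
Proof.
have E y : class_support (y ^: G) [set: gT] = y ^: [set: gT].
  apply/setP=> z; apply/imset2P/imsetP.
    by case=> _ d /imsetP[e _ ->] _ ->; exists (e * d); rewrite ?inE ?conjgM.
  by case=> d _ ->; exists y d; rewrite ?class_refl ?inE.
by rewrite !E; apply: classGidl; rewrite inE.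
Qed.

Lemma nsqrt_lt_of_conj_sqr a b c :
    commute a b -> b ^+ 2 = 1 -> b \notin <[a]> -> b ^ c = a ^+ 2 ->
  exists (G : {group gT}) (C1 C2 : {set gT}),
    [/\ C1 \in classes G, C2 \in classes G,
        class_support C1 [set: gT] = class_support C2 [set: gT] &
        forall g1 g2, g1 \in C1 -> g2 \in C2 -> nsqrt G g1 < nsqrt G g2].
Proof.
move=> cab b2 bNa bc; pose G := (<[a]> <*> <[b]>)%G.
have aG : a \in G by rewrite mem_gen // inE cycle_id.
have bG : b \in G by rewrite mem_gen // inE cycle_id orbT.
exists G, (b ^: G), (a ^+ 2 ^: G); split.
- exact: mem_classes.
- by rewrite mem_classes ?groupX.
- by rewrite -bc class_support_classJ.
move=> _ _ /imsetP[x xG ->] /imsetP[y yG ->].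
rewrite !nsqrtJ // nsqrt_join_cycle_eq0 //.
by apply/card_gt0P; exists a; rewrite inE aG eqxx.
Qed.

Lemma sqr_mul_involution x u : u ^+ 2 = 1 -> (x * u) ^+ 2 = x * x ^ u.
Proof.
by move=> u2; rewrite expgS expg1 conjgE -(mulg1 u^-1) -u2 expgS expg1 mulKg !mulgA.
Qed.

End ConjugateSquare.

(** [swapn] mirrors on indices what transpositions do on points, so that the
    identities between products of transpositions are settled by
    computation. *)
Definition swapn (i j k : nat) : nat :=
  if k == i then j else if k == j then i else k.

Section Eight.

Variable n : nat.
Hypothesis n_ge8 : 8 <= n.+1.

Let t i j : 'S_n.+1 := tperm (inord i) (inord j).

Lemma tperm_inord i j k : i < 8 -> j < 8 -> k < 8 ->
  t i j (inord k) = inord (swapn i j k).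
Proof.
move=> i8 j8 k8.
have E l : l < 8 -> (inord k == inord l :> 'I_n.+1) = (k == l).
  by move=> l8; rewrite -val_eqE /= !inordK // (leq_trans _ n_ge8).
by rewrite permE /= !E // /swapn; case: ifP => // _; case: ifP.
Qed.

Lemma tpermJ_inord i j k l : i < 8 -> j < 8 -> k < 8 -> l < 8 ->
  t i j ^ t k l = t (swapn k l i) (swapn k l j).
Proof. by move=> *; rewrite tpermJ !tperm_inord. Qed.

(** Here [a] is the product of the transposition (0 1) and the involution
    [s = (0 2)(1 3)] that carries it to (2 3): so [a] is a 4-cycle with
    [a ^+ 2 = (0 1) * (0 1) ^ s = (0 1)(2 3)]. *)
Lemma exists_conj_sqr : exists a b c : 'S_n.+1,
  [/\ commute a b, b ^+ 2 = 1, b \notin <[a]> & b ^ c = a ^+ 2].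
Proof.
have sqrMt x i j : (x * t i j) ^+ 2 = x * x ^ t i j.
  by apply: sqr_mul_involution; rewrite expgS expg1 tperm2.
pose s := t 0 2 * t 1 3; pose a := t 0 1 * s; pose b := t 4 5 * t 6 7.
have s2 : s ^+ 2 = 1 by rewrite sqrMt tpermJ_inord // tperm2.
(* The conjugator exchanges {0, 1, 2, 3} and {4, 5, 6, 7} by shifting by 4. *)
exists a, b, (t 0 4 * t 1 5 * (t 2 6 * t 3 7)); split.
- by apply/commgP/conjg_fixP; rewrite !conjMg !conjgM !tpermJ_inord.
- by rewrite sqrMt tpermJ_inord // tperm2.
(* The powers of [a] fix the point 4, which [b] moves to 5. *)
- apply/negP=> /cycleP[i /(congr1 (fun u : 'S_n.+1 => u (inord 4)))].
  have a4 : a (inord 4) = inord 4 by rewrite !permM !tperm_inord.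
  rewrite permX iter_fix // permM !tperm_inord //= => /(congr1 val) /=.
  by rewrite !inordK // (leq_trans _ n_ge8).
by rewrite (sqr_mul_involution _ _ _ s2) !conjMg !conjgM !tpermJ_inord.
Qed.

End Eight.

Theorem proposition1p2 (n : nat) (hn : 8 <= n) :
  exists (G : {group 'S_n}) (C1 C2 : {set 'S_n}),
    [/\ C1 \in classes G, C2 \in classes G,
        class_support C1 [set: 'S_n] = class_support C2 [set: 'S_n] &
        forall g1 g2 : 'S_n,
          g1 \in C1 -> g2 \in C2 -> nsqrt G g1 < nsqrt G g2].
Proof.
case: n hn => // n hn.
have [a [b [c [cab b2 bNa bc]]]] := exists_conj_sqr n hn.
exact: nsqrt_lt_of_conj_sqr cab b2 bNa bc.
Qed.
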